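(* Let $A$ be an $m\times m$ nonnegative definite hermitian matrix and let $k\in[m-1]$ with $k\le\operatorname{rank}A$. Let $I$ be any subset of $[m]$ of cardinality $k$ returned by the greedy algorithm (described in the context) on input $(A,k)$. Let $a_1,\dots,a_k$ be the $k$ maximal entries out of the $m$ diagonal entries of $A$. Then $$\big\|A-A[[m],I]\,A[I]^{-1}A[[m],I]^*\big\|_{\infty,e}\le\frac{\prod_{i=1}^k a_i}{\det A[I]}\,(k+1)\,\sigma_{k+1}(A).$$
   Context: $[m]=\{1,\dots,m\}$. $A[I,J]$ is the submatrix of $A$ with rows indexed by $I$ and columns indexed by $J$; $A[I]=A[I,I]$. $\|B\|_{\infty,e}=\max_{i,j}|b_{ij}|$ is the entrywise max-norm. $\sigma_1(A)\ge\sigma_2(A)\ge\cdots$ are the singular values of $A$, with $\sigma_j(A)=0$ for $j>\operatorname{rank}A$. Greedy algorithm. Input: nonnegative definite hermitian $A$ and $k\in[m]$. Initialize a working matrix $B=(b_{pq}):=A$, $I:=\emptyset$, $K:=[m]$, $t:=1$. Repeat: choose $i\in K$ with $b_{ii}=\max_{j\in K}b_{jj}$ (ties broken arbitrarily); if $b_{ii}=0$, set $I:=[k]$, $t:=0$ and exit; otherwise set $I:=I\cup\{i\}$, $K:=K\setminus\{i\}$, $t:=t\,b_{ii}$; if $|I|=k$, exit; for all $p,q\in K$ replace $b_{pq}$ by $b_{pq}-b_{pi}b_{iq}/b_{ii}$. Output: $I$ (of cardinality $k$) and $t=\det A[I]$. *)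

(* Defs.v *)
From mathcomp Require Import all_boot all_order all_algebra.
From mathcomp Require Import sesquilinear spectral.
From mathcomp Require Export matrix_normedtype.

Set Implicit Arguments.
Unset Strict Implicit.
Unset Printing Implicit Defensive.

Import Order.TTheory GRing.Theory Num.Theory.

Local Open Scope ring_scope.
Local Open Scope sesquilinear_scope.

(* The complex numbers are an arbitrary [C : numClosedFieldType] (for instance
   [R[i]] with [R : realType]).  Its order is the partial order of complex
   numbers, [x <= y] iff [y - x] is a nonnegative real; all quantities compared
   below are real. *)

Definition nonneg_definite (C : numClosedFieldType) (m : nat) (A : 'M[C]_m) :=
  A \is hermsymmx /\ forall x : 'cV[C]_m, 0 <= (x ^t* *m A *m x) 0 0.

(* A[I,J]; rows and columns are listed in increasing order. *)
Definition submx_of (C : numClosedFieldType) (m n : nat) (A : 'M[C]_(m, n))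
    (I : {set 'I_m}) (J : {set 'I_n}) : 'M[C]_(#|I|, #|J|) :=
  mxsub enum_val enum_val A.

(* A[I] *)
Definition principal_submx (C : numClosedFieldType) (m : nat) (A : 'M[C]_m)
    (I : {set 'I_m}) : 'M[C]_#|I| :=
  submx_of A I I.

(* A[[m],J], typed with m rows rather than #|[set: 'I_m]| rows. *)
Definition col_submx (C : numClosedFieldType) (m n : nat) (A : 'M[C]_(m, n))
    (J : {set 'I_n}) : 'M[C]_(m, #|J|) :=
  colsub enum_val A.

(* The n eigenvalues of B, with algebraic multiplicity, in no specified order. *)
Definition eigenvalues (C : numClosedFieldType) (n : nat) (B : 'M[C]_n) :
    seq C :=
  sval (closed_field_poly_normal (char_poly B)).

(* [sort >=%R] sorts in nonincreasing order as soon as the entries are real. *)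
Definition singular_values (C : numClosedFieldType) (m n : nat)
    (A : 'M[C]_(m, n)) : seq C :=
  sort >=%R [seq sqrtC z | z <- eigenvalues (A ^t* *m A)].

(* sigma_j, counted from j = 1. *)
Definition singular_value (C : numClosedFieldType) (m n : nat) (j : nat)
    (A : 'M[C]_(m, n)) : C :=
  (singular_values A)`_j.-1.

Definition sorted_diagonal (C : numClosedFieldType) (m : nat) (A : 'M[C]_m) :
    seq C :=
  sort >=%R [seq A i i | i : 'I_m].

Definition is_pivot (C : numClosedFieldType) (m : nat) (B : 'M[C]_m)
    (K : {set 'I_m}) (i : 'I_m) :=
  i \in K /\ forall j : 'I_m, j \in K -> B j j <= B i i.

Definition pivot_update (C : numClosedFieldType) (m : nat) (B : 'M[C]_m)
    (K : {set 'I_m}) (i : 'I_m) : 'M[C]_m :=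
  \matrix_(p, q)
    if (p \in K) && (q \in K) then B p q - B p i * B i q / B i i else B p q.

(* [greedy_loop k B I K t J s]: entering the loop body in state (B, I, K, t),
   the algorithm may exit with output (J, s).  Nondeterminism is the choice of
   the pivot among ties. *)
Inductive greedy_loop (C : numClosedFieldType) (m k : nat) :
    'M[C]_m -> {set 'I_m} -> {set 'I_m} -> C -> {set 'I_m} -> C -> Prop :=
| greedy_exit_zero B I K t i :
    is_pivot B K i -> B i i = 0 ->
    greedy_loop k B I K t [set j : 'I_m | (j < k)%N] 0
| greedy_exit_full B I K t i :
    is_pivot B K i -> B i i <> 0 -> #|i |: I| = k ->
    greedy_loop k B I K t (i |: I) (t * B i i)
| greedy_continue B I K t i J s :
    is_pivot B K i -> B i i <> 0 -> #|i |: I| <> k ->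
    greedy_loop k (pivot_update B (K :\ i) i) (i |: I) (K :\ i) (t * B i i) J s ->
    greedy_loop k B I K t J s.

Definition greedy_returns (C : numClosedFieldType) (m : nat) (A : 'M[C]_m)
    (k : nat) (J : {set 'I_m}) (s : C) :=
  greedy_loop k A set0 [set: 'I_m] 1 J s.

(* Main.v *)
Require Import Defs.
From mathcomp Require Import all_boot all_order all_algebra.
From mathcomp Require Import sesquilinear spectral.

Set Implicit Arguments.
Unset Strict Implicit.
Unset Printing Implicit Defensive.

Import Order.TTheory GRing.Theory Num.Theory.

Local Open Scope ring_scope.
Local Open Scope sesquilinear_scope.

(** The error matrix R = A - A[.,I] A[I]^-1 A[.,I]^* is the Schur residual of A
    with respect to the coordinates in I.  It is again nonnegative definite, so
    its largest entry in modulus sits on the diagonal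
    ([nonneg_definite_entry_le]), and each diagonal entry is a quotient of
    principal minors, R_jj = det A[I+j] / det A[I] ([det_residual]).  What has
    to be bounded is therefore a principal minor of size k+1.

    Let M be a principal submatrix of A of size k+1.  Its smallest eigenvalue is
    at most sigma = sigma_(k+1)(A), by a dimension count between the coordinate
    subspace of M and the span of the eigenvectors of A whose eigenvalue
    exceeds sigma ([small_form_vector]).  In terms of the elementary symmetric
    functions of the eigenvalues of M this says e_(k+1) <= sigma * e_k, that is,
    det M <= sigma * tr (adj M) ([det_le_adj_trace]).  The trace of the adjugate
    is a sum of k+1 principal minors of A of size k, each of which is at most
    the product of its diagonal entries ([hadamard]), hence at most the product
    of the k largest diagonal entries of A ([prod_diag_le]).  Together these
    give [det_mxsub_le].

    It remains that det A[I] is nonzero for the set I that the greedy algorithm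
    returns.  Its working matrix is, on the indices not yet chosen, the residual
    of A with respect to the chosen ones.  The residual R always satisfies
    rank (A - R) <= #|I|, and a zero maximal pivot forces R = 0; since
    k <= rank A this cannot happen before k pivots have been chosen, and with
    nonzero pivots A[I] stays nonsingular ([greedy_det_neq0]). *)

(** * Conjugate transposes and nonnegative definite matrices *)

Lemma adjmx_mul (C : numClosedFieldType) m n p
    (A : 'M[C]_(m, n)) (B : 'M_(n, p)) :
  (A *m B) ^t* = B ^t* *m A ^t*.
Proof. by rewrite trmx_mul map_mxM. Qed.

Lemma adjmxB (C : numClosedFieldType) m n (A B : 'M[C]_(m, n)) :
  (A - B) ^t* = A ^t* - B ^t*.
Proof. by rewrite linearB /= map_mxB. Qed.

Lemma adjmx_inv (C : numClosedFieldType) n (A : 'M[C]_n) :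
  (invmx A) ^t* = invmx (A ^t*).
Proof. by rewrite trmx_inv map_invmx. Qed.

Lemma adjmx1 (C : numClosedFieldType) n : (1%:M : 'M[C]_n) ^t* = 1%:M.
Proof. by rewrite trmx1 map_mx1. Qed.

Lemma hermitian_adjmx (C : numClosedFieldType) n (A : 'M[C]_n) :
  (A \is hermsymmx) = (A ^t* == A).
Proof. by rewrite is_hermitianmxE expr0 scale1r eq_sym. Qed.

Lemma adjmx_mul_self (C : numClosedFieldType) n (x : 'cV[C]_n) :
  (x ^t* *m x) 0 0 = \sum_i `|x i 0| ^+ 2.
Proof. by rewrite mxE; apply: eq_bigr => i _; rewrite !mxE mulrC normCK. Qed.

Lemma diag_form (C : numClosedFieldType) m n
    (P : 'M[C]_(m, n)) (d : 'rV_m) (x : 'cV_n) :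
  (x ^t* *m (P ^t* *m diag_mx d *m P) *m x) 0 0
    = \sum_i d 0 i * `|(P *m x) i 0| ^+ 2.
Proof.
rewrite !mulmxA -adjmx_mul -mulmxA mxE; apply: eq_bigr => i _.
by rewrite mul_mx_diag !mxE mulrC mulrA -normCK mulrC.
Qed.

Lemma adj_diag (R : comPzRingType) n (M : 'M[R]_n) i :
  (\adj M) i i = \det (mxsub (lift i) (lift i) M).
Proof.
rewrite mxE /cofactor addnn -signr_odd odd_double mul1r.
by rewrite row'Esub col'Esub -mxsubrc.
Qed.

Lemma nonneg_definite_congr (C : numClosedFieldType) m n
    (A : 'M[C]_m) (X : 'M_(m, n)) :
  nonneg_definite A -> nonneg_definite (X ^t* *m A *m X).
Proof.
move=> [hA pA]; split=> [|x]; last first.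
  by have := pA (X *m x); rewrite adjmx_mul !mulmxA.
rewrite hermitian_adjmx !adjmx_mul trmxCK -mulmxA.
by move: hA; rewrite hermitian_adjmx => /eqP->.
Qed.

Lemma nonneg_definite_adj (C : numClosedFieldType) m (A : 'M[C]_m) :
  nonneg_definite A -> A ^t* = A.
Proof. by case; rewrite hermitian_adjmx => /eqP. Qed.

Lemma nonneg_definite_diag_ge0 (C : numClosedFieldType) m (A : 'M[C]_m) i :
  nonneg_definite A -> 0 <= A i i.
Proof.
case=> _ /(_ (delta_mx i 0)).
by rewrite trmx_delta map_delta_mx -rowE -colE !mxE.
Qed.

Lemma nonneg_definite_spectral (C : numClosedFieldType) m (A : 'M[C]_m) :
    nonneg_definite A ->
  exists P : 'M[C]_m, exists d : 'rV[C]_m,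
    [/\ P *m P ^t* = 1%:M, P ^t* *m P = 1%:M,
        A = P ^t* *m diag_mx d *m P & forall i, 0 <= d 0 i].
Proof.
move=> Ann; have [hA _] := Ann.
pose P := spectralmx A.
have P_unitary : P \is unitarymx := spectral_unitarymx A.
exists P, (spectral_diag A).
have PP : P *m P ^t* = 1%:M by exact/unitarymxP.
have eA : A = P ^t* *m diag_mx (spectral_diag A) *m P.
  by rewrite -invmx_unitary //; apply/orthomx_spectralP/hermitian_normalmx.
split=> // [|i]; first exact: mulmx1C.
have := nonneg_definite_diag_ge0 i (nonneg_definite_congr (P ^t*) Ann).
rewrite trmxCK [X in _ *m X *m _]eA !mulmxA PP mul1mx -mulmxA PP mulmx1.
by rewrite !mxE eqxx mulr1n.
Qed.

Lemma nonneg_definite_det_ge0 (C : numClosedFieldType) n (M : 'M[C]_n) :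
  nonneg_definite M -> 0 <= \det M.
Proof.
case/nonneg_definite_spectral=> P [d [_ QP -> d0]].
by rewrite !det_mulmx mulrAC -det_mulmx QP det1 mul1r det_diag prodr_ge0.
Qed.

(** In spectral coordinates z = P x the form is the sum of the nonnegative terms
    d_i |z_i|^2; when it vanishes so does each term, and with it d_i z_i. *)
Lemma nonneg_definite_ker (C : numClosedFieldType) m (A : 'M[C]_m) (x : 'cV_m) :
  nonneg_definite A -> (x ^t* *m A *m x) 0 0 = 0 -> A *m x = 0.
Proof.
case/nonneg_definite_spectral=> P [d [_ _ -> d0]]; rewrite diag_form => q0.
rewrite -mulmxA -mulmxA.
have -> : diag_mx d *m (P *m x) = 0; last by rewrite mulmx0.
apply/matrixP=> i j; rewrite ord1 mul_diag_mx [RHS]mxE mxE.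
have /(_ i isT)/eqP := psumr_eq0P
  (fun i _ => mulr_ge0 (d0 i) (exprn_ge0 2 (normr_ge0 _))) q0.
by rewrite mulf_eq0 expf_eq0 normr_eq0 /= -mulf_eq0 => /eqP.
Qed.

Lemma nonneg_definite_col0 (C : numClosedFieldType) m (A : 'M[C]_m) i :
  nonneg_definite A -> A i i = 0 -> forall j, A j i = 0.
Proof.
move=> Ann Aii j; have /matrixP/(_ j 0) : A *m (delta_mx i 0 : 'cV_m) = 0.
  apply: nonneg_definite_ker => //.
  by rewrite trmx_delta map_delta_mx -rowE -colE !mxE.
by rewrite -colE !mxE.
Qed.

(** Writing A = P^* D P, the triangle inequality and 2|a||b| <= |a|^2 + |b|^2
    give 2|A_pq| <= A_pp + A_qq. *)
Lemma nonneg_definite_entry_le (C : numClosedFieldType) m (A : 'M[C]_m) p q b :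
  nonneg_definite A -> (forall i, A i i <= b) -> `|A p q| <= b.
Proof.
case/nonneg_definite_spectral=> P [d [_ _ eA d0]] Ab.
have AE p' q' : A p' q' = \sum_i d 0 i * ((P i p')^* * P i q').
  rewrite eA mxE; apply: eq_bigr => i _.
  by rewrite mul_mx_diag !mxE mulrAC [RHS]mulrC.
suff : 2 * `|A p q| <= A p p + A q q.
  move=> le2; rewrite -(ler_pM2l (@ltr0Sn C 1)); apply: le_trans le2 _.
  by rewrite mulr_natl mulr2n lerD.
rewrite !AE -big_split /=.
apply: le_trans (ler_wpM2l _ (ler_norm_sum _ _ _)) _ => //.
rewrite mulr_sumr; apply: ler_sum => i _.
rewrite !normrM norm_conjC (ger0_norm (d0 i)) mulrCA -mulrDr ler_wpM2l //.
rewrite ![_^* * _]mulrC -!normCK -subr_ge0.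
have -> : `|P i p| ^+ 2 + `|P i q| ^+ 2 - 2 * (`|P i p| * `|P i q|)
    = (`|P i p| - `|P i q|) ^+ 2.
  by rewrite sqrrB mulr_natl addrAC.
by rewrite real_exprn_even_ge0 // rpredB // normr_real.
Qed.

(** * Schur residuals *)

(** The columns of [selmx C f] are the basis vectors e_(f j), so that selecting
    rows or columns becomes a matrix product. *)
Definition selmx (C : numClosedFieldType) m n (f : 'I_n -> 'I_m) :
    'M[C]_(m, n) :=
  colsub f 1%:M.
Arguments selmx C {m n} f.

Local Notation coordmx C i := (selmx C (fun _ : 'I_1 => i)).

Lemma mulmx_selmx (C : numClosedFieldType) p m n
    (A : 'M[C]_(p, m)) (f : 'I_n -> 'I_m) :
  A *m selmx C f = colsub f A.
Proof. by rewrite mulmx_colsub mulmx1. Qed.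

Lemma adj_selmx_mulmx (C : numClosedFieldType) p m n
    (A : 'M[C]_(m, p)) (f : 'I_n -> 'I_m) :
  (selmx C f) ^t* *m A = rowsub f A.
Proof. by rewrite trmx_mxsub map_mxsub trmx1 map_mx1 mul_rowsub_mx mul1mx. Qed.

Lemma selmx_congr (C : numClosedFieldType) m n
    (A : 'M[C]_m) (f : 'I_n -> 'I_m) :
  (selmx C f) ^t* *m A *m selmx C f = mxsub f f A.
Proof.
by rewrite adj_selmx_mulmx mulmx_selmx; apply/matrixP=> i j; rewrite !mxE.
Qed.

Lemma selmx_isometry (C : numClosedFieldType) m n (f : 'I_n -> 'I_m) :
  injective f -> (selmx C f) ^t* *m selmx C f = 1%:M.
Proof.
move=> f_inj; rewrite adj_selmx_mulmx.
by apply/matrixP=> i j; rewrite !mxE (inj_eq f_inj).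
Qed.

Lemma nonneg_definite_mxsub (C : numClosedFieldType) m n
    (A : 'M[C]_m) (f : 'I_n -> 'I_m) :
  nonneg_definite A -> nonneg_definite (mxsub f f A).
Proof. by move=> Ann; rewrite -selmx_congr; apply: nonneg_definite_congr. Qed.

(** The m x m matrix left after eliminating the column space of E from A.  For
    E a selection of coordinates it is the Schur complement of the selected
    block, bordered by zero rows and columns; keeping the full size lets
    residuals with different E be compared without reindexing. *)
Definition residual (C : numClosedFieldType) m n
    (A : 'M[C]_m) (E : 'M[C]_(m, n)) : 'M_m :=
  A - A *m E *m invmx (E ^t* *m A *m E) *m (E ^t* *m A).

Section Residual.
Variables (C : numClosedFieldType) (m n : nat).
Variables (A : 'M[C]_m) (E : 'M[C]_(m, n)).
Hypothesis block_unit : E ^t* *m A *m E \in unitmx.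

Lemma residual_mulmx : residual A E *m E = 0.
Proof.
rewrite /residual mulmxBl -(mulmxA _ (E ^t* *m A)) -(mulmxA _ (invmx _)).
by rewrite mulVmx // mulmx1 subrr.
Qed.

Lemma residual_factor :
  residual A E = (1%:M - A *m E *m invmx (E ^t* *m A *m E) *m E ^t*) *m A.
Proof. by rewrite mulmxBl mul1mx /residual !mulmxA. Qed.

(** The residual is X^* A X, where X = 1 - E (E^* A E)^-1 E^* A is the
    projection along the range of E onto the A-orthogonal of that range. *)
Lemma residual_nonneg : nonneg_definite A -> nonneg_definite (residual A E).
Proof.
move=> Ann; have hA := nonneg_definite_adj Ann.
have -> : residual A E =
    (1%:M - E *m invmx (E ^t* *m A *m E) *m E ^t* *m A) ^t* *m A
      *m (1%:M - E *m invmx (E ^t* *m A *m E) *m E ^t* *m A).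
  rewrite adjmxB adjmx1 !adjmx_mul adjmx_inv !adjmx_mul trmxCK hA !mulmxA.
  rewrite -residual_factor mulmxBr mulmx1 !mulmxA.
  by rewrite residual_mulmx !mul0mx subr0.
exact: nonneg_definite_congr.
Qed.

(** Block Gaussian elimination: clearing the lower left block of
    [E F]^* A [E F] leaves F^* (residual A E) F in the lower right corner. *)
Lemma det_residual p (F : 'M[C]_(m, p)) :
  \det ((row_mx E F) ^t* *m A *m row_mx E F)
    = \det (E ^t* *m A *m E) * \det (F ^t* *m residual A E *m F).
Proof.
rewrite tr_row_mx map_col_mx -mulmxA mul_mx_row mul_col_row !mulmxA.
set G := E ^t* *m A *m E.
set N := block_mx G _ _ _.
pose L := block_mx (1%:M : 'M_n) 0 (- (F ^t* *m A *m E *m invmx G)) 1%:M.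
have <- : \det (L *m N) = \det N.
  by rewrite det_mulmx det_lblock !det1 !mul1r.
rewrite mulmx_block !mul1mx !mul0mx !addr0 !mulNmx -(mulmxA _ (invmx G) G).
rewrite mulVmx // mulmx1 addNr det_ublock; congr (_ * \det _).
by rewrite /residual mulmxBr mulmxBl addrC !mulmxA.
Qed.

End Residual.

Lemma pivot_block (C : numClosedFieldType) m (A : 'M[C]_m) i :
  (coordmx C i) ^t* *m A *m coordmx C i = (A i i)%:M.
Proof.
by rewrite selmx_congr; apply/matrixP=> a b; rewrite !ord1 !mxE mulr1n.
Qed.

Lemma pivot_unit (C : numClosedFieldType) m (A : 'M[C]_m) i :
  A i i != 0 -> (coordmx C i) ^t* *m A *m coordmx C i \in unitmx.
Proof. by move=> Ai; rewrite pivot_block unitmxE det_scalar expr1 unitfE. Qed.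

Lemma pivot_residual (C : numClosedFieldType) m (A : 'M[C]_m) i p q :
  residual A (coordmx C i) p q = A p q - A p i * A i q / A i i.
Proof.
rewrite /residual pivot_block invmx_scalar mul_mx_scalar -scalemxAl.
rewrite mulmx_selmx adj_selmx_mulmx [LHS]mxE [X in _ + X]mxE [X in - X]mxE.
by rewrite mxE big_ord1 !mxE mulrC.
Qed.

(** Hadamard's inequality, by elimination of the first coordinate: det M is
    M_00 times the determinant of the Schur complement, whose diagonal entries
    M_jj - |M_0j|^2 / M_00 are at most those of M. *)
Lemma hadamard (C : numClosedFieldType) n (M : 'M[C]_n) :
  nonneg_definite M -> \det M <= \prod_i M i i.
Proof.
elim: n M => [|n IH] M Mnn; first by rewrite det_mx00 big_ord0.
have Mge i : 0 <= M i i by exact: nonneg_definite_diag_ge0.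
have [M0|M0] := eqVneq (M 0 0) 0.
  rewrite (expand_det_col _ 0) big1 ?prodr_ge0 // => i _.
  by rewrite (nonneg_definite_col0 Mnn M0) mul0r.
set E := coordmx C (0 : 'I_n.+1).
set F := selmx C (fun j : 'I_n => rshift 1 j : 'I_n.+1).
have EF : row_mx E F = 1%:M :> 'M_(1 + n).
  rewrite -[1%:M]hsubmxK; congr row_mx; apply/matrixP => i j; rewrite !mxE //.
  by rewrite ord1; congr (_ == _)%:R; apply/val_inj.
have := det_residual (pivot_unit M0) F.
rewrite EF adjmx1 mul1mx mulmx1 => ->.
rewrite pivot_block det_scalar expr1 selmx_congr big_ord_recl ler_wpM2l //.
have Rnn := nonneg_definite_mxsub (fun j : 'I_n => rshift 1 j : 'I_n.+1)
  (residual_nonneg (pivot_unit M0) Mnn).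
apply: le_trans (IH _ Rnn) _.
apply: ler_prod => j _; rewrite (nonneg_definite_diag_ge0 j Rnn) /=.
have -> : lift ord0 j = rshift 1 j by apply/val_inj.
rewrite mxE pivot_residual gerBl divr_ge0 //.
have /matrixP/(_ (rshift 1 j) 0) <- := nonneg_definite_adj Mnn.
by rewrite !mxE mulrC -normCK exprn_ge0.
Qed.

(** * Nonincreasing rearrangements of nonnegative sequences *)

Section SortedNonneg.
Variables (C : numDomainType).
Implicit Types s t : seq C.

Lemma nonneg_ge_total s :
  {in s, forall x, 0 <= x} -> {in s &, total (>=%R : rel C)}.
Proof. by move=> s0 x y xs ys; rewrite /= orbC real_leVge ?ger0_real ?s0. Qed.

Lemma ge_transitive : transitive (>=%R : rel C).
Proof. by move=> x y z yx xz; apply: le_trans xz yx. Qed.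

Lemma sorted_sort_nonneg s :
  {in s, forall x, 0 <= x} -> sorted >=%R (sort >=%R s).
Proof. by move/nonneg_ge_total/sort_sorted_in; apply; apply: allss. Qed.

Lemma subseq_prod_le t s :
    subseq t s -> sorted >=%R s -> {in s, forall x, 0 <= x} ->
  \prod_(x <- t) x <= \prod_(i < size t) s`_i.
Proof.
elim: s t => [|x s IH] [|y t] //= st ss s0; rewrite ?big_nil ?big_ord0 //.
have s0' : {in s, forall x, 0 <= x}.
  by move=> z zs; apply: s0; rewrite inE zs orbT.
have ss' := path_sorted ss.
have [exy|nxy] := eqVneq y x.
  rewrite exy eqxx in st; rewrite big_cons big_ord_recl /= exy.
  by rewrite ler_wpM2l ?IH // s0 ?mem_head.
rewrite (negPf nxy) in st.
apply: le_trans (IH _ st ss' s0') _ => /=; apply: ler_prod => i _.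
have i_s : (i < size s)%N by apply: leq_trans (ltn_ord i) (size_subseq st).
rewrite s0' ?mem_nth //=.
by have /(pathP 0)/(_ i i_s) := ss.
Qed.

Lemma count_sort_le s k :
    {in s, forall x, 0 <= x} -> (k < size s)%N ->
  (count (fun x : C => ~~ (x <= (sort >=%R s)`_k)%R) s <= k)%N.
Proof.
move=> s0 ks; set a := (sort _ _)`_k.
rewrite -(seq.permP (permEl (perm_sort >=%R s)) (fun x => ~~ (x <= a))).
rewrite -[sort _ _](cat_take_drop k) count_cat.
rewrite [X in (_ + X <= _)%N](_ : _ = 0%N) ?addn0.
  by apply: leq_trans (count_size _ _) _; rewrite size_take size_sort ks.
apply/eqP; rewrite -leqn0 leqNgt -has_count; apply/hasPn => y /(nthP 0)[i].
rewrite size_drop size_sort nth_drop => ik <- {y}; rewrite negbK.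
apply: (sorted_leq_nth ge_transitive lexx 0 (sorted_sort_nonneg s0)).
- by rewrite inE size_sort.
- by rewrite inE size_sort -ltn_subRL.
- exact: leq_addr.
Qed.

End SortedNonneg.

Lemma sorted_diagonal_ge0 (C : numClosedFieldType) m (A : 'M[C]_m) i :
  nonneg_definite A -> 0 <= (sorted_diagonal A)`_i.
Proof.
move=> Ann.
have [isz|/(nth_default 0)->//] := ltnP i (size (sorted_diagonal A)).
have : (sorted_diagonal A)`_i \in sorted_diagonal A by apply: mem_nth.
by rewrite mem_sort => /mapP[j _ ->]; apply: nonneg_definite_diag_ge0.
Qed.

(** Sorting preserves the subsequence relation, so the chosen diagonal entries,
    once sorted, form a subsequence of the sorted diagonal. *)
Lemma prod_diag_le (C : numClosedFieldType) m n
    (A : 'M[C]_m) (f : 'I_n -> 'I_m) :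
    nonneg_definite A -> injective f ->
  \prod_j A (f j) (f j) <= \prod_(i < n) (sorted_diagonal A)`_i.
Proof.
move=> Ann f_inj.
pose s := [seq A i i | i : 'I_m].
have s0 : {in s, forall x, 0 <= x}.
  by move=> _ /mapP[i _ ->]; apply: nonneg_definite_diag_ge0.
(* The entries selected by f, listed in the order in which they occur in s. *)
pose t := [seq A i i | i <- enum (codom f)].
have st : subseq t s.
  by apply: map_subseq; rewrite enumT /enum_mem; apply: filter_subseq.
have tE : perm_eq t [seq A (f j) (f j) | j : 'I_n].
  have -> : [seq A (f j) (f j) | j : 'I_n] = [seq A i i | i <- codom f].
    by rewrite -map_comp.
  apply/perm_map/uniq_perm; first exact: enum_uniq.
    exact/injectiveP.
  by move=> i; rewrite mem_enum.
have szt : size t = n by rewrite (perm_size tE) size_map size_enum_ord.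
have tr : {in s & &, transitive (>=%R : rel C)}.
  by move=> x y z _ _ _; apply: ge_transitive.
have := subseq_prod_le (subseq_sort_in (nonneg_ge_total s0) tr st)
  (sorted_sort_nonneg s0).
rewrite size_sort szt => le_prod; apply: le_trans (le_prod _).
  by rewrite (perm_big t) /= ?perm_sort // (perm_big _ tE) big_map big_enum.
by move=> x; rewrite mem_sort; apply: s0.
Qed.

(** * Singular values and principal minors *)

Lemma char_poly_congr (R : comUnitRingType) n (B P Q : 'M[R]_n) :
  Q *m P = 1%:M -> char_poly (Q *m B *m P) = char_poly B.
Proof.
move=> QP; rewrite /char_poly /char_poly_mx.
have -> : 'X%:M - map_mx polyC (Q *m B *m P) =
   map_mx polyC Q *m ('X%:M - map_mx polyC B) *m map_mx polyC P.
  rewrite !map_mxM /= mulmxBr mulmxBl scalar_mxC -[X in _ = X - _]mulmxA.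
  by rewrite -[X in _ = _ *m X - _]map_mxM /= QP map_mx1 mulmx1.
rewrite !det_mulmx mulrAC -det_mulmx -[_ *m _]map_mxM /= QP.
by rewrite map_mx1 det1 mul1r.
Qed.

(** A^* A has the spectral decomposition of A with d_i squared. *)
Lemma singular_values_nonneg (C : numClosedFieldType) m
    (A P : 'M[C]_m) (d : 'rV_m) :
    P *m P ^t* = 1%:M -> A = P ^t* *m diag_mx d *m P ->
    (forall i, 0 <= d 0 i) ->
  singular_values A = sort >=%R [seq d 0 i | i : 'I_m].
Proof.
move=> PP eA d0.
have QP : P ^t* *m P = 1%:M by exact: mulmx1C.
apply/esym/perm_sort_inP.
- by apply: nonneg_ge_total => _ /mapP[i _ ->].
- by move=> x y z _ _ _; apply: ge_transitive.
- by move=> x y _ _; rewrite andbC => /le_anti.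
have -> : [seq d 0 i | i : 'I_m]
    = [seq sqrtC z | z <- [seq d 0 i ^+ 2 | i : 'I_m]].
  by rewrite -map_comp; apply: eq_map => i /=; rewrite sqrCK.
apply/perm_map/prod_XsubC_eq.
rewrite /eigenvalues; case: closed_field_poly_normal => r /=.
rewrite (monicP (char_poly_monic _)) scale1r => <-.
have -> : A ^t* *m A = P ^t* *m diag_mx (\row_i (d 0 i ^+ 2)) *m P.
  have dc : (diag_mx d) ^t* = diag_mx d.
    rewrite tr_diag_mx map_diag_mx; congr diag_mx; apply/rowP=> i.
    by rewrite mxE; apply: geC0_conj.
  rewrite eA !adjmx_mul trmxCK dc -!mulmxA [P *m (_ *m _)]mulmxA PP mul1mx.
  rewrite [diag_mx d *m (_ *m _)]mulmxA; congr (_ *m (_ *m _)).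
  rewrite mul_diag_mx; apply/matrixP=> i j; rewrite !mxE mulrnAr.
  by rewrite expr2.
rewrite char_poly_congr // char_poly_trig ?diag_mx_is_trig // big_map big_enum.
by apply: eq_bigr => i _; rewrite !mxE eqxx mulr1n.
Qed.

Lemma singular_value_ge0 (C : numClosedFieldType) m n (A : 'M[C]_m) :
  nonneg_definite A -> 0 <= singular_value n A.
Proof.
case/nonneg_definite_spectral=> P [d [PP _ eA d0]].
rewrite /singular_value (singular_values_nonneg PP eA d0).
set s := sort _ _; have [ns|/(nth_default 0)->//] := ltnP n.-1 (size s).
have : s`_n.-1 \in s by apply: mem_nth.
by rewrite mem_sort => /mapP[i _ ->].
Qed.

(** The half of Cauchy interlacing that is used here.  At most n-1 eigenvalues
    of A exceed sigma_n(A), so some nonzero vector of the n-dimensional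
    coordinate subspace given by f has no component along their
    eigenvectors. *)
Lemma small_form_vector (C : numClosedFieldType) m n
    (A : 'M[C]_m) (f : 'I_n -> 'I_m) :
    nonneg_definite A -> injective f -> (0 < n)%N ->
  exists2 y : 'cV[C]_n, y != 0 &
    (y ^t* *m mxsub f f A *m y) 0 0
      <= singular_value n A * (y ^t* *m y) 0 0.
Proof.
move=> Ann f_inj n0.
have [P [d [PP QP eA d0]]] := nonneg_definite_spectral Ann.
rewrite /singular_value (singular_values_nonneg PP eA d0).
set s := [seq _ | i : _]; set a := _`_ _.
have s0 : {in s, forall x, 0 <= x} by move=> _ /mapP[i _ ->].
have nm : (n.-1 < size s)%N.
  rewrite size_map size_enum_ord prednK //.
  by have := leq_card f f_inj; rewrite !card_ord.
pose S := [set i | ~~ (d 0 i <= a)].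
have cS : (#|S| < n)%N.
  have := count_sort_le s0 nm; rewrite -/a count_map -ltnS prednK //.
  apply: leq_ltn_trans; rewrite -sum1_card -sum1_count big_enum_cond /=.
  by apply: eq_leq; apply: eq_bigl => i; rewrite !inE.
(* N y lists the components of the vector along the eigenvectors in S. *)
pose N := rowsub (enum_val : 'I_#|S| -> _) (P *m selmx C f).
have /rowV0Pn[v vN v0] : kermx N^T != 0.
  by rewrite kermx_eq0 /row_free neq_ltn (leq_ltn_trans (rank_leq_col _)).
exists v^T; first by rewrite trmx_eq0.
set y := v^T.
have yN i : i \in S -> (P *m (selmx C f *m y)) i 0 = 0.
  move=> iS.
  have /sub_kermxP/(congr1 trmx) := vN; rewrite trmx_mul trmxK trmx0.
  move/matrixP/(_ (enum_rank_in iS i) 0).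
  by rewrite mul_rowsub_mx [in LHS]mxE enum_rankK_in // mulmxA [RHS]mxE.
have -> : (y ^t* *m y) 0 0 = \sum_i `|(P *m (selmx C f *m y)) i 0| ^+ 2.
  rewrite -adjmx_mul_self !adjmx_mul mulmxA -[in RHS](mulmxA _ (P ^t*)) QP.
  by rewrite mulmx1 mulmxA -(mulmxA (y ^t*)) selmx_isometry // mulmx1.
rewrite -selmx_congr eA.
have -> : y ^t* *m ((selmx C f) ^t* *m (P ^t* *m diag_mx d *m P) *m selmx C f)
    *m y
  = (selmx C f *m y) ^t* *m (P ^t* *m diag_mx d *m P) *m (selmx C f *m y).
  by rewrite adjmx_mul !mulmxA.
rewrite diag_form mulr_sumr; apply: ler_sum => i _.
have [iS|] := boolP (i \in S); first by rewrite yN // normr0 expr0n !mulr0.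
by rewrite inE negbK => da; rewrite ler_wpM2r // exprn_ge0.
Qed.

(** The hypothesis on y says that M has an eigenvalue at most a.  When M is
    singular the right-hand side is a sum of nonnegative minors; otherwise
    tr (adj M) = det M * tr (M^-1), and tr (M^-1) is at least the inverse of
    that eigenvalue. *)
Lemma det_le_adj_trace (C : numClosedFieldType) n (M : 'M[C]_n) (y : 'cV_n) a :
    nonneg_definite M -> 0 <= a -> y != 0 ->
    (y ^t* *m M *m y) 0 0 <= a * (y ^t* *m y) 0 0 ->
  \det M <= a * \tr (\adj M).
Proof.
move=> Mnn a0 y0.
have [P [d [PP QP eM d0]]] := nonneg_definite_spectral Mnn.
have detM : \det M = \prod_i d 0 i.
  by rewrite eM !det_mulmx mulrAC -det_mulmx QP det1 mul1r det_diag.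
set z := P *m y.
have z0 : z != 0.
  by apply: contraNneq y0 => Py; rewrite -[y]mul1mx -QP -mulmxA -/z Py mulmx0.
have -> : (y ^t* *m y) 0 0 = \sum_i `|z i 0| ^+ 2.
  by rewrite -adjmx_mul_self adjmx_mul mulmxA -(mulmxA _ (P ^t*)) QP mulmx1.
rewrite {1}eM diag_form -/z => le_a.
have [i da] : exists i, d 0 i <= a.
  apply/existsP; apply: contraNT z0; rewrite negb_exists => /forallP da.
  have da' i : 0 < d 0 i - a by rewrite subr_gt0 real_ltNge ?ger0_real.
  have s0 : \sum_i (d 0 i - a) * `|z i 0| ^+ 2 = 0.
    apply: le_anti; rewrite sumr_ge0 ?andbT => [|i _]; last first.
      by rewrite mulr_ge0 ?exprn_ge0 // ltW.
    under eq_bigr do rewrite mulrBl.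
    by rewrite sumrB -mulr_sumr subr_le0.
  apply/eqP/colP=> i; rewrite [RHS]mxE; apply/eqP.
  have /(_ i isT)/eqP := psumr_eq0P
    (fun i _ => mulr_ge0 (ltW (da' i)) (exprn_ge0 2 (normr_ge0 _))) s0.
  by rewrite mulf_eq0 expf_eq0 normr_eq0 gt_eqF.
have [M0|M0] := eqVneq (\det M) 0.
  rewrite M0 mulr_ge0 // sumr_ge0 // => j _; rewrite adj_diag.
  exact/nonneg_definite_det_ge0/nonneg_definite_mxsub.
have dgt0 j : 0 < d 0 j.
  by move: M0; rewrite detM => /prodf_neq0/(_ j isT); rewrite lt_def d0 andbT.
pose N := P ^t* *m diag_mx (\row_j (d 0 j)^-1) *m P.
have MN : M *m N = 1%:M.
  rewrite {1}eM /N !mulmxA -(mulmxA _ P) PP mulmx1 -(mulmxA _ (diag_mx d)).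
  rewrite mulmx_diag -[RHS]QP; congr (_ *m P).
  rewrite -[RHS]mulmx1; congr (_ *m _).
  rewrite -diag_const_mx; congr diag_mx; apply/rowP=> j.
  by rewrite !mxE mulfV // gt_eqF.
have -> : \adj M = \det M *: N.
  by rewrite -[\adj M]mulmx1 -MN mulmxA mul_adj_mx mul_scalar_mx.
rewrite linearZ /= mxtrace_mulC mulmxA PP mul1mx mxtrace_diag mulrCA.
rewrite ler_peMr ?(nonneg_definite_det_ge0 Mnn) //.
rewrite (bigD1 i) //= mulrDr mxE.
have : 1 <= a / d 0 i by rewrite ler_pdivlMr // mul1r.
move/le_trans; apply; rewrite lerDl mulr_ge0 // sumr_ge0 // => j _.
by rewrite mxE invr_ge0.
Qed.

Lemma det_mxsub_le (C : numClosedFieldType) m n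
    (A : 'M[C]_m) (f : 'I_n -> 'I_m) :
    nonneg_definite A -> (0 < n)%N -> injective f ->
  \det (mxsub f f A)
    <= (\prod_(i < n.-1) (sorted_diagonal A)`_i) * n%:R * singular_value n A.
Proof.
move=> Ann n0 f_inj.
have [y y0 le_y] := small_form_vector Ann f_inj n0.
have s0 := singular_value_ge0 n Ann.
apply: le_trans
  (det_le_adj_trace (nonneg_definite_mxsub f Ann) s0 y0 le_y) _.
rewrite mulrC ler_wpM2r // -[in n%:R](card_ord n) mulr_natr -sumr_const.
apply: ler_sum => i _; rewrite adj_diag.
have -> : mxsub (lift i) (lift i) (mxsub f f A)
    = mxsub (f \o lift i) (f \o lift i) A.
  by apply/matrixP=> p q; rewrite !mxE.
apply: le_trans (hadamard (nonneg_definite_mxsub _ Ann)) _.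
under eq_bigr do rewrite mxE.
by apply: prod_diag_le => //; apply: inj_comp f_inj lift_inj.
Qed.

(** * The greedy algorithm *)

(** R is what remains of A after eliminating the coordinates in I one by one.
    These properties characterise residuals without mentioning A[I]^-1, so that
    they pass from one pivot to the next without the quotient formula for Schur
    complements.  The last one expresses that A[I] is nonsingular. *)
Record eliminated (C : numClosedFieldType) m (A : 'M[C]_m)
    (I : {set 'I_m}) (R : 'M[C]_m) : Prop :=
  Eliminated {
    eliminated_nonneg : nonneg_definite R;
    eliminated_sub : (R <= A)%MS;
    eliminated_rank : (\rank (A - R)%R <= #|I|)%N;
    eliminated_col0 : forall i j, i \in I -> R j i = 0;
    eliminated_free : forall x : 'cV[C]_m,
      (forall i, i \notin I -> x i 0 = 0) -> A *m x = 0 -> x = 0 }.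

Lemma eliminated0 (C : numClosedFieldType) m (A : 'M[C]_m) :
  nonneg_definite A -> eliminated A set0 A.
Proof.
move=> Ann; split=> //.
- by rewrite subrr mxrank0.
- by move=> i j; rewrite inE.
- by move=> x x0 _; apply/colP=> i; rewrite x0 ?inE // mxE.
Qed.

(** If x is supported on I + i and A x = 0, then R x = 0 because the rows of R
    are combinations of the rows of A.  The columns of R in I vanish, so R x is
    x_i times column i of R; its entry x_i R_ii shows x_i = 0, and x is
    supported on I. *)
Lemma eliminated_pivot (C : numClosedFieldType) m (A R : 'M[C]_m)
    (I : {set 'I_m}) i :
    eliminated A I R -> i \notin I -> R i i != 0 ->
  eliminated A (i |: I) (residual R (coordmx C i)).
Proof.
move=> [Rnn sRA rk col0 free] iI Ri.
have U := pivot_unit Ri; split.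
- exact: residual_nonneg.
- by rewrite residual_factor // (submx_trans (submxMl _ _)).
- set E := selmx _ _; rewrite cardsU1 iI addnC.
  have -> : A - residual R E
      = (A - R) + R *m E *m invmx (E ^t* *m R *m E) *m (E ^t* *m R).
    by rewrite /residual opprB addrCA addrC.
  apply: leq_trans (mxrank_add _ _) _; apply: leq_add => //.
  by apply: leq_trans (mxrankM_maxr _ _) _; apply: rank_leq_row.
- move=> l j; rewrite !inE pivot_residual => /orP[/eqP->|lI].
    by rewrite mulfK // subrr.
  by rewrite !(col0 _ _ lI) mulr0 mul0r subrr.
- move=> x x0 Ax; apply: free => // j jI.
  have [-> {j jI}|ji] := eqVneq j i; last first.
    by apply: x0; rewrite !inE negb_or ji.
  have /matrixP/(_ i 0) : R *m x = 0.
    by have /submxP[P ->] := sRA; rewrite -mulmxA Ax mulmx0.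
  rewrite !mxE (bigD1 i) //= big1 => [|j ji].
    by rewrite addr0 => /eqP; rewrite mulf_eq0 (negPf Ri) => /eqP.
  have [jI|jI] := boolP (j \in I); first by rewrite col0 // mul0r.
  by rewrite x0 ?mulr0 // !inE negb_or ji.
Qed.

Lemma eliminated_det_neq0 (C : numClosedFieldType) m (A R : 'M[C]_m)
    (I : {set 'I_m}) :
    nonneg_definite A -> eliminated A I R ->
  \det (principal_submx A I) != 0.
Proof.
move=> Ann [_ _ _ _ free].
rewrite -unitfE -[_ \is a _]unitmxE -unitmx_tr -row_free_unit -kermx_eq0.
apply/rowV0P=> v /sub_kermxP/(congr1 trmx).
rewrite trmx_mul trmxK trmx0 => Gv.
set f : 'I_#|I| -> 'I_m := enum_val.
(* The kernel vector extended by zero outside I annihilates the form of A. *)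
have x0 : selmx C f *m v^T = 0.
  apply: free => [i iI|].
    rewrite mxE big1 // => j _; rewrite !mxE.
    by case: eqP => [eij|]; [rewrite eij enum_valP in iI | rewrite mul0r].
  apply: nonneg_definite_ker => //.
  rewrite (_ : _ *m _ = (v^T) ^t* *m (principal_submx A I *m v^T)).
    by rewrite Gv mulmx0 mxE.
  by rewrite -[principal_submx A I]selmx_congr adjmx_mul !mulmxA.
apply: trmx_inj; rewrite trmx0 -[v^T]mul1mx -(selmx_isometry _ enum_val_inj).
by rewrite -mulmxA x0 mulmx0.
Qed.

(** A vanishing maximal pivot makes the whole diagonal of R vanish, hence R = 0
    and rank A <= #|I| < k; so every run that starts with k <= rank A ends
    after k nonzero pivots. *)
Lemma greedy_det_neq0 (C : numClosedFieldType) m k (A B R : 'M[C]_m)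
    (I K J : {set 'I_m}) (t s : C) :
    nonneg_definite A -> (k <= \rank A)%N -> greedy_loop k B I K t J s ->
    K = ~: I -> (#|I| < k)%N -> eliminated A I R ->
    (forall p q, p \in K -> q \in K -> B p q = R p q) ->
  \det (principal_submx A J) != 0.
Proof.
move=> Ann kr loop; elim: loop R => {B I K t J s}.
- move=> B I K _ i [iK piv] Bi0 R KI Ik elim BR.
  have [Rnn _ rk col0 _] := elim.
  suff R0 : R = 0 by move: rk; rewrite R0 subr0 leqNgt (leq_trans Ik).
  apply/matrixP=> p q; rewrite [RHS]mxE; apply: nonneg_definite_col0 => //.
  have [qI|qI] := boolP (q \in I); first exact: col0.
  have qK : q \in K by rewrite KI inE.
  apply: le_anti; rewrite (nonneg_definite_diag_ge0 _ Rnn) andbT.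
  by rewrite -BR // -Bi0 piv.
- move=> B I K _ i [iK _] /eqP Bi _ R KI _ elim BR.
  apply: (eliminated_det_neq0 Ann); apply: (eliminated_pivot elim).
    by rewrite KI inE in iK.
  by rewrite -BR.
- move=> B I K _ i J _ [iK _] /eqP Bi ck _ IH R KI Ik elim BR.
  have iI : i \notin I by rewrite KI inE in iK.
  have Ri : R i i != 0 by rewrite -BR.
  apply: (IH _ _ _ (eliminated_pivot elim iI Ri)).
  + by rewrite KI; apply/setP=> j; rewrite !inE negb_or.
  + by move/eqP: ck; rewrite ltn_neqAle cardsU1 iI Ik andbT.
  + move=> p q pK qK; rewrite mxE pK qK pivot_residual.
    by move: pK qK; rewrite !inE => /andP[_ pK] /andP[_ qK]; rewrite !BR.
Qed.

(** * The entrywise error bound *)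

Theorem proposition14 (C : numClosedFieldType) (m k : nat) (A : 'M[C]_m)
    (I : {set 'I_m}) (t : C)
    (A_nonneg : nonneg_definite A)
    (k_ge1 : (1 <= k)%N) (k_lt_m : (k < m)%N) (k_le_rank : (k <= \rank A)%N)
    (card_I : #|I| = k) (greedy_I : greedy_returns A k I t) :
  mx_norm (A - col_submx A I *m invmx (principal_submx A I)
                 *m (col_submx A I) ^t*)
  <= (\prod_(i < k) (sorted_diagonal A)`_i) / \det (principal_submx A I)
       * (k.+1)%:R * singular_value k.+1 A.
Proof.
have detI : \det (principal_submx A I) != 0.
  apply: (greedy_det_neq0 A_nonneg k_le_rank greedy_I _ _
    (eliminated0 A_nonneg)) => //; first by rewrite setC0.
  by rewrite cards0.
set E : 'M_(m, #|I|) := selmx C enum_val.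
have GE : E ^t* *m A *m E = principal_submx A I by rewrite selmx_congr.
have colE : col_submx A I = A *m E by rewrite mulmx_selmx.
have U : E ^t* *m A *m E \in unitmx by rewrite GE unitmxE unitfE.
have det_gt0 : 0 < \det (principal_submx A I).
  rewrite lt_def detI nonneg_definite_det_ge0 //.
  exact: nonneg_definite_mxsub.
have -> : A - col_submx A I *m invmx (principal_submx A I)
    *m (col_submx A I) ^t* = residual A E.
  by rewrite colE -GE adjmx_mul (nonneg_definite_adj A_nonneg).
have Rnn := residual_nonneg U A_nonneg.
set b := _ * singular_value _ _.
have s0 := singular_value_ge0 k.+1 A_nonneg.
have prod0 : 0 <= \prod_(i < k) (sorted_diagonal A)`_i.
  by apply: prodr_ge0 => i _; apply: sorted_diagonal_ge0.
have b0 : 0 <= b by rewrite !mulr_ge0 ?invr_ge0 ?(ltW det_gt0).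
have Rb i : residual A E i i <= b.
  (* f lists the elements of I, then i, which may repeat an element of I. *)
  pose f (j : 'I_(#|I| + 1)) :=
    match split j with inl l => enum_val l | inr _ => i end.
  have EF : row_mx E (coordmx C i) = selmx C f.
    by apply/matrixP=> p q; rewrite mxE [RHS]mxE /f; case: split => l;
       rewrite !mxE.
  have := det_residual U (coordmx C i).
  rewrite EF GE pivot_block det_scalar expr1 selmx_congr.
  move=> detf; rewrite -(ler_pM2l det_gt0) -detf.
  have -> : \det (principal_submx A I) * b
      = \prod_(i < k) (sorted_diagonal A)`_i * k.+1%:R * singular_value k.+1 A.
    by rewrite /b -!mulrA mulrCA mulVKf.
  have [->|f_det] := eqVneq (\det (mxsub f f A)) 0; first by rewrite !mulr_ge0.
  have f_inj : injective f.
    move=> j l fjl; apply/eqP; apply: contraNT f_det => jl.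
    by apply/eqP/(determinant_alternate jl) => h; rewrite !mxE fjl.
  apply: le_trans (det_mxsub_le A_nonneg _ f_inj) _; first by rewrite addn1.
  by rewrite addn1 card_I.
have [->//|/mx_norm_neq0[[p q] -> /=]] := eqVneq (mx_norm (residual A E)) 0.
exact: nonneg_definite_entry_le.
Qed.
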